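(* Let $F$ be a totally imaginary number field and $\mu=(a^\eta,b^\eta)_{\eta:F\to\mathbb{C}}$ a strongly pure weight of $M_\alpha\simeq\mathrm{Res}_{F/\mathbb{Q}}GL_2$ with purity weight $\mathbf{w}$. Let $\sigma_f\in\mathrm{Coh}_{!!}(\mathrm{Res}_{F/\mathbb{Q}}GL_2,\mu)$ and let $\sigma=\sigma_f\otimes\sigma_\infty$ be the associated cohomological cuspidal automorphic representation of $GL_2(\mathbb{A}_F)$. Put $$\ell_1(\mu)=\min_{\eta}\{|2b^\eta-\mathbf{w}-1|,|2a^\eta-\mathbf{w}+1|\},\qquad \ell_2(\mu)=\min_\eta\{|a^\eta+b^\eta-\mathbf{w}|\},$$ $$\ell_3(\mu)=\min_\eta\{|2a^\eta+4b^\eta-3\mathbf{w}-1|,|4a^\eta+2b^\eta-3\mathbf{w}+1|\},$$ the minima being over all embeddings $\eta:F\to\mathbb{C}$. The following are equivalent: (1) The point $s=-\frac32$ is a critical point for both $L(s,\sigma)L(2s,\omega_\sigma)L(3s,\sigma\otimes\omega_\sigma)$ and $L(1+s,\sigma)L(1+2s,\omega_\sigma)L(1+3s,\sigma\otimes\omega_\sigma)$. (2) $-1-\ell_1(\mu)\le\mathbf{w}\le-5+\ell_1(\mu)$, $\;-2-\ell_2(\mu)\le\mathbf{w}\le-4+\ell_2(\mu)$, $\;-\frac73-\frac{\ell_3(\mu)}3\le\mathbf{w}\le-\frac{11}3+\frac{\ell_3(\mu)}3$, $\;\ell_1(\mu)\ge2$, $\ell_2(\mu)\ge1$ and $\ell_3(\mu)\ge2$.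 (3) There exists a balanced Kostant representative $w=(w^\eta)\in W^{P_\alpha}$ such that $w^{-1}\cdot\mu$ is a dominant weight of $G=\mathrm{Res}_{F/\mathbb{Q}}(G_2/F)$.
   Context: Weights. $\mu=(\mu^\eta)_{\eta:F\to\mathbb{C}}$ with $\mu^\eta=(a^\eta,b^\eta)\in\mathbb{Z}^2$, $a^\eta\ge b^\eta$. It is strongly pure with purity weight $\mathbf{w}\in\mathbb{Z}$ if $a^{\gamma^{-1}\circ\eta}+b^{\gamma^{-1}\circ\bar\eta}=\mathbf{w}$ for all $\eta:F\to\mathbb{C}$ and all $\gamma\in\mathrm{Gal}(\overline{\mathbb{Q}}/\mathbb{Q})$; in particular $(a^{\bar\eta},b^{\bar\eta})=(\mathbf{w}-b^\eta,\mathbf{w}-a^\eta)$. Representation. $\mathrm{Coh}_{!!}(\mathrm{Res}_{F/\mathbb{Q}}GL_2,\mu)$ is the set of finite parts of cuspidal automorphic representations of $GL_2(\mathbb{A}_F)$ contributing to cuspidal cohomology with coefficients in the local system of highest weight $\mu$. The archimedean part is $\sigma_\infty=\otimes_v\mathbb{J}_{\mu_v}$, where for a complex place $v$ with embeddings $\eta,\bar\eta$, $\mathbb{J}_{\mu_v}$ is the normalized parabolically induced representation of $GL_2(\mathbb{C})$ from the Borel character $z^{-b^\eta+1/2}\bar z^{-a^{\bar\eta}-1/2}\otimes z^{-a^\eta-1/2}\bar z^{-b^{\bar\eta}+1/2}$. $\omega_\sigma$ is the central character of $\sigma$. Critical points. A point $s_0$ (in $\frac12+\mathbb{Z}$ for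 $\pi=\sigma$ or $\sigma\otimes\omega_\sigma$, in $\mathbb{Z}$ for $\pi=\omega_\sigma$) is critical for $L(s,\pi)$ if the archimedean factors $L_\infty(s,\pi)$ and $L_\infty(1-s,\pi^\vee)$ are both finite at $s_0$. Condition (1) means: $-\frac32,-\frac12$ are critical for $L(s,\sigma)$; $-3,-2$ are critical for $L(s,\omega_\sigma)$; and $-\frac92,-\frac72$ are critical for $L(s,\sigma\otimes\omega_\sigma)$. Root data. $G_2$ has simple roots $\alpha$ (short), $\beta$ (long), positive roots $\alpha,\beta,\alpha+\beta,2\alpha+\beta,3\alpha+\beta,3\alpha+2\beta$, $\rho=5\alpha+3\beta$. $P_\alpha=M_\alpha U_\alpha$ is the standard maximal parabolic of $G$ whose Levi contains $\alpha$; the weight $(a,b)$ of $M_{0,\alpha}\simeq GL_2$ is the weight $a(2\alpha+\beta)+b(\alpha+\beta)$ of $G_2$, so it is dominant for $G_2$ iff $0\le b\le a$. The Weyl group is $W=\prod_{\eta:F\to\mathbb{C}}W_0$ with $W_0$ the Weyl group of $G_2$; $W^{P_\alpha}=\{w=(w^\eta):(w^\eta)^{-1}\alpha>0\ \forall\eta\}$; the twisted action is $w\cdot\lambda=(w^\eta(\lambda^\eta+\rho)-\rho)_\eta$, with dominance required at every $\eta$. An element $w\in W^{P_\alpha}$ is balanced if $l(w^\eta)+l(w^{\bar\eta})=\dim(U_{P_{0,\alpha}})=5$ for every $\eta$. *)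

(* Defs.v *)
From HB Require Import structures.
From mathcomp Require Import all_boot all_order all_algebra all_field.
From mathcomp Require Import complex.
From mathcomp Require Import all_classical all_reals all_analysis.
From mathcomp Require Import ring.

Set Implicit Arguments.
Unset Strict Implicit.
Unset Printing Implicit Defensive.

Import Order.TTheory GRing.Theory Num.Theory numFieldNormedType.Exports.
Local Open Scope classical_set_scope.
Local Open Scope complex_scope.
Local Open Scope ring_scope.

(* Every embedding of a number field in the complex numbers has its image in
   the field algC of algebraic complex numbers, which is thus used as target;
   the automorphisms of algC form Gal(Qbar/Q), and complex conjugation is one
   of them. *)
Definition embedding (F : fieldExtType rat) := {rmorphism F -> algC}.

Definition emb_conj (F : fieldExtType rat) (eta : embedding F) : embedding F :=
  (Num.conj : {rmorphism algC -> algC}) \o eta.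

Definition totally_imaginary (F : fieldExtType rat) : Prop :=
  forall eta : embedding F, ~ (forall x : F, eta x \is Num.real).

(* The complex places of F are indexed by 'I_r; place v is {iota v, its
   conjugate}, and F_v is identified with the complex numbers by iota v. *)
Definition place_embeddings (F : fieldExtType rat) (r : nat)
    (iota : 'I_r -> embedding F) : Prop :=
  forall eta : embedding F,
    exists! v : 'I_r, eta = iota v \/ eta = emb_conj (iota v).

(* mu eta is the pair (a^eta, b^eta). *)
Definition weight (F : fieldExtType rat) := embedding F -> int * int.

Definition dominant_weight (F : fieldExtType rat) (mu : weight F) : Prop :=
  forall eta, (mu eta).2 <= (mu eta).1.

(* gamma' is the inverse of gamma. *)
Definition strongly_pure (F : fieldExtType rat) (mu : weight F) (w : int) :
    Prop :=
  forall (gamma gamma' : {rmorphism algC -> algC}),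
    cancel gamma gamma' -> cancel gamma' gamma ->
  forall eta : embedding F,
    (mu (gamma' \o eta : embedding F)).1
    + (mu (gamma' \o emb_conj eta : embedding F)).2 = w.

Definition is_min (A : set int) (m : int) : Prop := A m /\ lbound A m.

Section ArchimedeanLFactors.
Variable R : realType.
Local Notation C := R[i].

Definition cexp (z : C) : C :=
  (expR (complex.Re z))%:C * (cos (complex.Im z) +i* sin (complex.Im z)).

(* Gauss's formula for the entire function 1/Gamma:
   1/Gamma(s) = lim_n s (s + 1) ... (s + n) / (n! n^s). *)
Definition inv_Gamma_seq (s : C) (n : nat) : C :=
  (\prod_(k < n.+1) (s + k%:R)) / n`!%:R * cexp (- s * (ln n%:R)%:C).

Definition Gamma (s : C) : C :=
  (limn (inv_Gamma_seq s : nat -> C^o))^-1.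

Definition Gamma_C (s : C) : C :=
  2%:R * cexp (- s * (ln (2%:R * pi))%:C) * Gamma s.

(* A meromorphic function has a finite value at s0, i.e. no pole there, iff it
   is bounded on a punctured neighbourhood of s0. *)
Definition finite_at (L : C -> C) (s0 : C) : Prop :=
  bounded_near (L : C^o -> C^o) ((s0 : C^o)^').

(* The quasi-character z |-> z^p zbar^q of the multiplicative group of the
   complex numbers; it is well defined because p - q is an integer. *)
Record quasichar := Quasichar {
  qc_p : C;
  qc_q : C;
  qc_int : exists n : int, qc_p - qc_q = n%:~R }.

Fact qc_one_int : exists n : int, 0 - 0 = n%:~R :> C.
Proof. by exists 0; rewrite subrr. Qed.

Definition qc_one := Quasichar qc_one_int.

Fact qc_mul_int (x y : quasichar) : exists n : int,
  qc_p x + qc_p y - (qc_q x + qc_q y) = n%:~R.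
Proof.
case: x y => [p q [m hm]] [p' q' [n hn]] /=; exists (m + n).
by rewrite rmorphD /= -hm -hn opprD addrACA.
Qed.

Definition qc_mul (x y : quasichar) := Quasichar (qc_mul_int x y).

Fact qc_inv_int (x : quasichar) : exists n : int,
  - qc_p x - - qc_q x = n%:~R.
Proof.
case: x => [p q [m hm]] /=; exists (- m).
by rewrite rmorphN /= -hm opprD.
Qed.

Definition qc_inv (x : quasichar) := Quasichar (qc_inv_int x).

(* L(s, z^p zbar^q) = Gamma_C(s + max(p, q)); the formula below for the
   maximum also makes sense when p and q are not real. *)
Definition qc_L (chi : quasichar) (s : C) : C :=
  Gamma_C (s + (qc_p chi + qc_q chi) / 2%:R
             + `|qc_p chi - qc_q chi| / 2%:R).

(* The representation of GL_n over the complex numbers obtained by normalized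
   parabolic induction from the quasi-characters of the tuple. *)
Definition principal_series (n : nat) := n.-tuple quasichar.

Definition central_char n (pi : principal_series n) : quasichar :=
  foldr qc_mul qc_one pi.

Definition twist n (pi : principal_series n) (om : quasichar) :
    principal_series n :=
  [tuple of map (qc_mul om) pi].

Definition contragredient n (pi : principal_series n) : principal_series n :=
  [tuple of map qc_inv pi].

Definition local_L n (pi : principal_series n) (s : C) : C :=
  \prod_(i < n) qc_L (tnth pi i) s.

Definition L_infty r n (pi : 'I_r -> principal_series n) (s : C) : C :=
  \prod_(v < r) local_L (pi v) s.

(* For GL_n the critical points are sought in (n - 1)/2 + Z. *)
Definition critical r n (pi : 'I_r -> principal_series n) (s0 : C) : Prop :=
  [/\ exists k : int, s0 = (n%:R - 1) / 2%:R + k%:~R,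
      finite_at (L_infty pi) s0
    & finite_at (fun s => L_infty (fun v => contragredient (pi v)) (1 - s))
        s0].

Fact J_char1_int (ab ab' : int * int) : exists n : int,
  (- ab.2%:~R + 1 / 2%:R) - (- ab'.1%:~R - 1 / 2%:R) = n%:~R :> C.
Proof.
exists (ab'.1 - ab.2 + 1); rewrite rmorphD rmorphB /=.
by field.
Qed.

Fact J_char2_int (ab ab' : int * int) : exists n : int,
  (- ab.1%:~R - 1 / 2%:R) - (- ab'.2%:~R + 1 / 2%:R) = n%:~R :> C.
Proof.
exists (ab'.2 - ab.1 - 1); rewrite !rmorphB /=.
by field.
Qed.

(* The inducing characters of J_mu at the place of eta, ab and ab' being the
   values of mu at eta and at its conjugate:
   z^(- b + 1/2) zbar^(- a' - 1/2) and z^(- a - 1/2) zbar^(- b' + 1/2). *)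
Definition J_char1 (ab ab' : int * int) := Quasichar (J_char1_int ab ab').
Definition J_char2 (ab ab' : int * int) := Quasichar (J_char2_int ab ab').

Definition J_mu (F : fieldExtType rat) (mu : weight F) (eta : embedding F) :
    principal_series 2 :=
  [tuple J_char1 (mu eta) (mu (emb_conj eta));
         J_char2 (mu eta) (mu (emb_conj eta))].

(* The point s is critical for
   L(t + s, sigma) L(t + 2s, omega_sigma) L(t + 3s, sigma (x) omega_sigma):
   each factor is critical at its own argument. *)
Definition critical_product r (sigma_infty : 'I_r -> principal_series 2)
    (t s : C) : Prop :=
  let omega v := central_char (sigma_infty v) in
  [/\ critical sigma_infty (t + s),
      critical (fun v => [tuple omega v]) (t + 2%:R * s)
    & critical (fun v => twist (sigma_infty v) (omega v)) (t + 3%:R * s)].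

End ArchimedeanLFactors.

(* Weights of G_2 are column vectors of coordinates in the basis
   (alpha, beta), alpha being the short simple root. *)
Definition g2weight := 'cV[int]_2.

Definition alpha : g2weight := delta_mx ord0 ord0.
Definition beta : g2weight := delta_mx ord_max ord0.

Definition positive_roots : seq g2weight :=
  [:: alpha; beta; alpha + beta; alpha *+ 2 + beta; alpha *+ 3 + beta;
      alpha *+ 3 + beta *+ 2].

Definition rho : g2weight := alpha *+ 5 + beta *+ 3.

(* The simple coroots, as linear forms on weights: <alpha, alpha^v> = 2,
   <beta, alpha^v> = -3, <alpha, beta^v> = -1 and <beta, beta^v> = 2. *)
Definition alpha_check : 'rV[int]_2 := \row_j (if j == ord0 then 2 else -3).
Definition beta_check : 'rV[int]_2 := \row_j (if j == ord0 then -1 else 2).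

Definition g2dominant (lambda : g2weight) : Prop :=
  0 <= (alpha_check *m lambda) ord0 ord0 /\
  0 <= (beta_check *m lambda) ord0 ord0.

Definition s_alpha : 'M[int]_2 := 1%:M - alpha *m alpha_check.
Definition s_beta : 'M[int]_2 := 1%:M - beta *m beta_check.

Definition weyl_word (u : seq bool) : 'M[int]_2 :=
  \prod_(c <- u) (if c then s_alpha else s_beta).

Definition in_W0 (w : 'M[int]_2) : Prop := exists u, w = weyl_word u.

(* n is the smallest length of an expression of w in the simple reflections. *)
Definition has_length (w : 'M[int]_2) (n : nat) : Prop :=
  (exists u, w = weyl_word u /\ size u = n) /\
  (forall u, w = weyl_word u -> (n <= size u)%N).

Definition dot (w : 'M[int]_2) (lambda : g2weight) : g2weight :=
  w *m (lambda + rho) - rho.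

(* The weight (a, b) of the Levi factor GL_2, as a weight of G_2. *)
Definition levi_weight (ab : int * int) : g2weight :=
  (alpha *+ 2 + beta) *~ ab.1 + (alpha + beta) *~ ab.2.

Definition kostant_P_alpha (F : fieldExtType rat)
    (w : embedding F -> 'M[int]_2) : Prop :=
  forall eta, in_W0 (w eta) /\ (w eta)^-1 *m alpha \in positive_roots.

(* 5 is the dimension of the unipotent radical of P_alpha. *)
Definition balanced (F : fieldExtType rat) (w : embedding F -> 'M[int]_2) :
    Prop :=
  forall eta, exists m n : nat,
    [/\ has_length (w eta) m, has_length (w (emb_conj eta)) n
      & (m + n = 5)%N].

(* Main.v *)
(* Gauss's products P_n(s) for 1/Gamma(s) satisfy P_(n+1)/P_n = 1 + O(1/n^2)
   locally uniformly, so they converge and, for a fixed large N, the limit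
   differs from P_N by at most |P_N|/2 on a given disc: 1/Gamma has the same
   zeros there as the elementary function P_N.  As Gamma has no zeros, an
   archimedean L-factor is finite at a point iff none of its Gamma factors has
   a pole.  This turns (1) into inequalities between integers at each place,
   which are those of (2).

   On the other side, w^-1 . mu is dominant iff w is the Kostant element whose
   length is the number of coroots that are negative on mu + rho, and being
   balanced means that at the conjugate embedding the complementary number of
   them is negative.  The signs of the five coroots at an embedding and at its
   conjugate are opposite, in the appropriate order, iff (2) holds there. *)

Require Import Defs.
From HB Require Import structures.
From mathcomp Require Import all_boot all_order all_algebra all_field.
From mathcomp Require Import complex.
From mathcomp Require Import all_classical all_reals all_analysis.
From mathcomp Require Import ring lra zify.

Set Implicit Arguments.
Unset Strict Implicit.
Unset Printing Implicit Defensive.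

Import Order.TTheory GRing.Theory Num.Theory numFieldNormedType.Exports.
Local Open Scope classical_set_scope.
Local Open Scope complex_scope.
Local Open Scope ring_scope.
Import ComplexField.Normc.

(** * Complex norms and limits *)

Section ComplexNorm.
Variable R : realType.
Local Notation C := R[i].

Lemma normrE_normc (z : C) : `|z| = (normc z)%:C.
Proof. by []. Qed.

Lemma normc_ge0 (z : C) : 0 <= normc z.
Proof. by rewrite -lecR -normrE_normc normr_ge0. Qed.

Lemma normc_eq0 (z : C) : (normc z == 0) = (z == 0).
Proof. by rewrite -(inj_eq (@complexI R)) -normrE_normc normr_eq0. Qed.

Lemma normc_real (x : R) : normc x%:C = `|x|.
Proof. by apply: complexI; rewrite -normrE_normc normc_def /= expr0n addr0 sqrtr_sqr. Qed.

Lemma normc_nat n : normc (n%:R : C) = n%:R.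
Proof. by rewrite -(rmorph_nat (real_complex R)) normc_real normr_nat. Qed.

Lemma normcD (x y : C) : normc (x + y) <= normc x + normc y.
Proof. by rewrite -lecR rmorphD /= -!normrE_normc ler_normD. Qed.

Lemma normcNE (x : C) : normc (- x) = normc x.
Proof. by apply: complexI; rewrite -!normrE_normc normrN. Qed.

Lemma normc_sub (x y : C) : normc x <= normc y + normc (x - y).
Proof. by rewrite -{1}(subrK y x) addrC; apply: normcD. Qed.

Lemma normcB (x y : C) : normc (x - y) = normc (y - x).
Proof. by rewrite -normcNE opprB. Qed.

Lemma le_Re_normc (z : C) : `|complex.Re z| <= normc z.
Proof. by rewrite -lecR -normrE_normc normc_ge_Re. Qed.

Lemma normc_sqr (z : C) : normc z ^+ 2 = complex.Re z ^+ 2 + complex.Im z ^+ 2.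
Proof. by apply: complexI; rewrite rmorphXn /= -normrE_normc add_Re2_Im2. Qed.

Lemma le_Im_normc (z : C) : `|complex.Im z| <= normc z.
Proof.
rewrite -(@ler_pXn2r _ 2) ?nnegrE ?normc_ge0 // normc_sqr -normrX ger0_norm ?sqr_ge0 //.
by rewrite lerDr sqr_ge0.
Qed.

Lemma normc_le_ReIm (z : C) : normc z <= `|complex.Re z| + `|complex.Im z|.
Proof.
rewrite -(@ler_pXn2r _ 2) ?nnegrE ?normc_ge0 ?addr_ge0 // normc_sqr sqrrD.
by rewrite !real_normK ?num_real // addrAC lerDl mulrn_wge0 // mulr_ge0.
Qed.

Lemma cvg_normcP (u : nat -> C) (l : C) :
  (u : nat -> C^o) @ \oo --> (l : C^o) <-> normc (u n - l) @[n --> \oo] --> (0 : R).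
Proof.
split=> [/cvgrPdist_lt h|/cvgrPdist_lt h].
  apply/cvgrPdist_lt => e e0; have := h e%:C; rewrite ltcR => /(_ e0).
  apply: filterS => n; rewrite normrE_normc ltcR normcB sub0r normrN.
  by rewrite ger0_norm ?normc_ge0.
apply/cvgrPdist_lt => e; rewrite ltcE /= => /andP[/eqP ei e0].
have := h _ e0; apply: filterS => n.
rewrite sub0r normrN ger0_norm ?normc_ge0 // normrE_normc normcB.
by rewrite ltcE /= ei eqxx.
Qed.

Lemma cvg_complex (u : nat -> C) (x y : R) :
  complex.Re (u n) @[n --> \oo] --> x -> complex.Im (u n) @[n --> \oo] --> y ->
  (u : nat -> C^o) @ \oo --> ((x +i* y) : C^o).
Proof.
move=> ux uy; apply/cvg_normcP.
apply: (@squeeze_cvgr _ _ _ _ (fun=> 0)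
  (fun n => `|complex.Re (u n) - x| + `|complex.Im (u n) - y|)).
- near=> n; rewrite normc_ge0 /=; apply: le_trans (normc_le_ReIm _) _.
  by case: (u n) => a b /=.
- exact: cvg_cst.
- rewrite -[X in _ --> X](addr0 (0 : R)); apply: cvgD.
    by apply/norm_cvg0P; rewrite -(subrr x); apply: cvgB ux (cvg_cst _).
  by apply/norm_cvg0P; rewrite -(subrr y); apply: cvgB uy (cvg_cst _).
Unshelve. all: by end_near. Qed.

(** A telescoping substitute for [1 / n^2]: its sum from a positive [N] on is [1 / N]. At [n = 0]
    the convention [0^-1 = 0] makes it negative. *)
Definition inv_gap (n : nat) : R := n%:R^-1 - n.+1%:R^-1.

Lemma inv_gap_ge0 n : (0 < n)%N -> 0 <= inv_gap n.
Proof. by move=> n0; rewrite subr_ge0 lef_pV2 ?posrE ?ltr0n // ler_nat. Qed.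

(** From [N] on, [v n + B / n] decreases and [v n - B / n] increases. The first is thus bounded
    below and converges, and [B / n] tends to 0. *)
Lemma cvg_inv_gap (v : nat -> R) (B : R) (N : nat) : 0 <= B ->
  (forall n, (N <= n)%N -> `|v n.+1 - v n| <= B * inv_gap n) ->
  cvgn v.
Proof.
move=> B0 hv.
have vle n : (v (n + N).+1 + B * (n + N).+1%:R^-1 <= v (n + N)%N + B * (n + N)%:R^-1)
    && (v (n + N)%N - B * (n + N)%:R^-1 <= v (n + N).+1 - B * (n + N).+1%:R^-1).
  have /hv : (N <= n + N)%N by rewrite leq_addl.
  rewrite /inv_gap ler_norml mulrBr.
  by move: (B * _) (B * _) => x y; lra.
have ln n : v N - B * N%:R^-1 <= v (n + N)%N - B * (n + N)%:R^-1.
  elim: n => [|n IHn]; first by rewrite add0n.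
  by apply: le_trans IHn _; rewrite addSn; case/andP: (vle n).
have cw : cvgn (fun n => v (n + N)%N + B * (n + N)%:R^-1).
  apply: nonincreasing_is_cvgn.
    by apply/nonincreasing_seqP => n; rewrite addSn; case/andP: (vle n).
  exists (v N - B * N%:R^-1) => _ [n _ <-]; apply: le_trans (ln n) _.
  by rewrite lerD2l ge0_cp // mulr_ge0 ?invr_ge0.
have cB : (fun n : nat => B * n%:R^-1) @ \oo --> (0 : R).
  rewrite -(mulr0 B); apply: cvgM; first exact: cvg_cst.
  by rewrite -(cvg_shiftS _); exact: cvg_harmonic.
case/cvg_ex: cw => l /= cl; apply/cvg_ex; exists (l - 0); rewrite -(cvg_shiftn N).
have -> : (fun n => v (n + N)%N) = (fun n => v (n + N)%N + B * (n + N)%:R^-1)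
   \- (fun n => B * (n + N)%:R^-1) by apply/funext => n; rewrite /= addrK.
by apply: cvgB cl _; rewrite (cvg_shiftn N (fun n => B * n%:R^-1)).
Qed.

(** The relative steps add up to at most [K / N <= 1 / 4]. By induction [u n] stays within
    [normc (u N) / 2] of [u N], hence [normc (u n)] is at most [2 * normc (u N)]; the steps then
    have an absolute bound, and [cvg_inv_gap] applies to the real and imaginary parts. *)
Lemma near_constant_cvg (u : nat -> C) (K : R) (N : nat) :
    (0 < N)%N -> 0 <= K -> 4 * K <= N%:R ->
    (forall n, (N <= n)%N -> normc (u n.+1 - u n) <= K * inv_gap n * normc (u n)) ->
  exists2 l : C, (u : nat -> C^o) @ \oo --> (l : C^o) &
    normc (l - u N) <= normc (u N) / 2.
Proof.
move=> N0 K0 KN hu.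
have N0' : 0 < N%:R :> R by rewrite ltr0n.
have KN' : K * N%:R^-1 <= 1 / 4 by rewrite ler_pdivrMr //; lra.
set b := normc (u N); have b0 : 0 <= b by apply: normc_ge0.
have gapM n : K * inv_gap n = K * n%:R^-1 - K * n.+1%:R^-1 by rewrite /inv_gap mulrBr.
have Kn n : 0 <= K * n%:R^-1 by rewrite mulr_ge0 ?invr_ge0.
have half n d : d <= 2 * b * (K * N%:R^-1 - K * n%:R^-1) -> d <= b / 2.
  have := mulr_ge0 b0 (Kn n); have : 0 <= b * (1 / 4 - K * N%:R^-1).
    by rewrite mulr_ge0 // subr_ge0.
  by lra.
have dist n : (N <= n)%N -> normc (u n - u N) <= 2 * b * (K * N%:R^-1 - K * n%:R^-1).
  elim: n => [|n IHn]; first by rewrite leqn0 => /eqP N00; rewrite N00 in N0.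
  rewrite leq_eqVlt => /orP[/eqP <-|]; first by rewrite !subrr normc0 mulr0.
  rewrite ltnS => Nn; have := hu _ Nn; have {IHn}dn := IHn Nn.
  have := normcD (u n.+1 - u n) (u n - u N); rewrite addrA subrK.
  have un : normc (u n) <= 2 * b.
    by have := normc_sub (u n) (u N); have := half _ _ dn; rewrite -/b; lra.
  have g0 := mulr_ge0 K0 (inv_gap_ge0 (leq_trans N0 Nn)).
  have := ler_wpM2l g0 un; rewrite gapM; move: dn.
  move: (K * n%:R^-1) (K * n.+1%:R^-1) (K * N%:R^-1).
  by move: (normc _) (normc _) (normc _) => *; lra.
have dist' n : (N <= n)%N -> normc (u n - u N) <= b / 2.
  by move=> Nn; apply: half (dist n Nn).
have bnd n : (N <= n)%N -> normc (u n.+1 - u n) <= 2 * b * K * inv_gap n.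
  move=> Nn; apply: le_trans (hu n Nn) _.
  have := normc_sub (u n) (u N); have := dist' n Nn; rewrite -/b.
  have g0 := mulr_ge0 K0 (inv_gap_ge0 (leq_trans N0 Nn)).
  move=> d1 d2; have un : normc (u n) <= 2 * b by lra.
  by have := ler_wpM2l g0 un; lra.
have b2K : 0 <= 2 * b * K by rewrite !mulr_ge0.
have /cvg_ex[x cx] : cvgn (fun n => complex.Re (u n)).
  apply: (@cvg_inv_gap _ (2 * b * K) N) => // n Nn; apply: le_trans (bnd n Nn).
  by apply: le_trans (le_Re_normc _); case: (u n.+1) (u n) => ? ? [].
have /cvg_ex[y cy] : cvgn (fun n => complex.Im (u n)).
  apply: (@cvg_inv_gap _ (2 * b * K) N) => // n Nn; apply: le_trans (bnd n Nn).
  by apply: le_trans (le_Im_normc _); case: (u n.+1) (u n) => ? ? [].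
have cl := cvg_complex cx cy; exists (x +i* y) => //.
apply/ler_addgt0Pr => e e0.
move/cvg_normcP/cvgrPdist_lt: cl => /(_ e e0).
move=> h; have [n /andP[]] : exists n, (normc (u n - (x +i* y)) < e) && (N <= n)%N.
  have [M _ hM] := h; exists (maxn M N); rewrite leq_maxr andbT.
  have := hM (maxn M N) (leq_maxl _ _).
  by rewrite /= sub0r normrN ger0_norm ?normc_ge0.
rewrite normcB => h1 Nn; have := dist' n Nn.
have := normcD (x +i* y - u n) (u n - u N); rewrite addrA subrK.
move: (normc _) (normc _) (normc _) h1 => *; lra.
Qed.
End ComplexNorm.

(** * Quantitative bounds for the complex exponential *)

Section ComplexExponential.
Variable R : realType.
Local Notation C := R[i].

Lemma sin_bound (x : R) : `|sin x| <= `|x|.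
Proof.
wlog x0 : x / 0 <= x => [hw|].
  by have [/hw//|/ltW x0] := leP 0 x; rewrite -normrN -sinN -(normrN x) hw ?oppr_ge0.
have [|c _] := @MVT_segment R sin cos 0 x x0 (fun y _ => is_derive_sin y).
  exact/continuous_subspaceT/continuous_sin.
rewrite sin0 !subr0 => ->; rewrite normrM ler_piMl // ler_norml cos_geN1.
exact: cos_le1.
Qed.

Lemma cos_bound (x : R) : `|cos x - 1| <= x ^+ 2.
Proof.
have e : cos x - 1 = - (sin (x / 2) ^+ 2 *+ 2).
  by rewrite -{1}(divfK (_ : 2 != 0 :> R) x) // mulr_natr cos_mulr2n cos2sin2; ring.
rewrite e normrN ger0_norm ?mulrn_wge0 ?sqr_ge0 //.
have := sin_bound (x / 2); rewrite -(@ler_pXn2r _ 2) ?nnegrE //.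
by rewrite !real_normK ?num_real // exprMn; have := sqr_ge0 x; lra.
Qed.

Lemma sin_sub_bound (x : R) : `|sin x - x| <= `|x| ^+ 3.
Proof.
wlog x0 : x / 0 <= x => [hw|].
  have [/hw//|/ltW x0] := leP 0 x.
  by rewrite -normrN opprD -sinN -(normrN x) hw ?oppr_ge0.
have [|c] := @MVT_segment R sin cos 0 x x0 (fun y _ => is_derive_sin y).
  exact/continuous_subspaceT/continuous_sin.
rewrite in_itv /= => /andP[c0 cx]; rewrite sin0 !subr0 => ->.
rewrite -{2}(mul1r x) -mulrBl normrM exprSr ler_wpM2r //.
apply: le_trans (cos_bound c) _; rewrite (ger0_norm x0).
by rewrite ler_pXn2r ?nnegrE.
Qed.

(** Only [1 + x <= expR x] is used, at [x] and at [- x]: the latter gives [expR x * (1 - x) <= 1],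
    so that [(expR x - 1 - x) * (1 - x) <= x ^+ 2], where [1 - x >= 1 / 2]. *)
Lemma expR_bound (x : R) : `|x| <= 1 / 2 -> `|expR x - 1 - x| <= 2 * x ^+ 2.
Proof.
rewrite ler_norml => /andP[x1 x2]; have h := expR_ge1Dx x.
rewrite ger0_norm; last by lra.
have h' := expR_ge1Dx (- x); rewrite expRN in h'.
have e0 := expR_gt0 x; set e := expR x in h h' e0 *.
have : e * (1 + - x) <= 1 by rewrite -ler_pdivlMl // mulr1.
have : 0 <= (e - 1 - x) * (1 / 2 - x) by rewrite mulr_ge0; lra.
lra.
Qed.

Lemma cexpD (z w : C) : cexp (z + w) = cexp z * cexp w.
Proof.
case: z w => [a b] [c d]; rewrite /cexp /= expRD sinD cosD.
by apply/eqP; rewrite eq_complex /=; apply/andP; split; apply/eqP; ring.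
Qed.

Lemma normc_cexp (z : C) : normc (cexp z) = expR (complex.Re z).
Proof.
rewrite /cexp normcM normc_real ger0_norm ?expR_ge0 //=.
by rewrite cos2Dsin2 sqrtr1 mulr1.
Qed.

(** The real and imaginary parts split into four errors, each at most [2 * normc z ^+ 2]; the
    constant 14 is generous. *)
Lemma cexp_bound (z : C) : normc z <= 1 / 2 ->
  normc (cexp z - 1 - z) <= 14 * normc z ^+ 2.
Proof.
move=> z2; have zx := le_Re_normc z; have zy := le_Im_normc z.
have n0 := normc_ge0 z.
apply: le_trans (normc_le_ReIm _) _.
move: (normc z : R) z2 zx zy n0 => n; case: z => x y /= n2 xn yn n0.
rewrite !mul0r subr0 addr0 subr0.
have x2 : x ^+ 2 <= n ^+ 2 by rewrite -(real_normK (num_real x)) ler_pXn2r ?nnegrE.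
have y2 : y ^+ 2 <= n ^+ 2 by rewrite -(real_normK (num_real y)) ler_pXn2r ?nnegrE.
have y3 : `|y| ^+ 3 <= n ^+ 2.
  apply: le_trans (_ : n ^+ 3 <= _); first by rewrite ler_pXn2r ?nnegrE.
  by rewrite exprSr ler_piMr ?sqr_ge0 //; lra.
have ex := expR_bound (le_trans xn n2).
have e0 := expR_gt0 x; have e2 : expR x <= 2.
  by move: ex; have := le_trans xn n2; rewrite !ler_norml; nra.
have e1 : `|expR x - 1| <= 2 * n.
  have := ler_normD (expR x - 1 - x) x; rewrite subrK; nra.
have -> : expR x * cos y - 1 - x = expR x * (cos y - 1) + (expR x - 1 - x) by ring.
have -> : expR x * sin y - y = expR x * (sin y - y) + (expR x - 1) * y by ring.
have a1 : `|expR x * (cos y - 1)| <= 2 * n ^+ 2.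
  by rewrite normrM (ger0_norm (ltW e0)) ler_pM ?(ltW e0) // (le_trans (cos_bound y)).
have a2 : `|expR x * (sin y - y)| <= 2 * n ^+ 2.
  by rewrite normrM (ger0_norm (ltW e0)) ler_pM ?(ltW e0) // (le_trans (sin_sub_bound y)).
have a3 : `|(expR x - 1) * y| <= (2 * n) * n by rewrite normrM ler_pM.
have ex' : `|expR x - 1 - x| <= 2 * n ^+ 2 by apply: le_trans ex _; rewrite ler_pM2l.
apply: le_trans (lerD (le_trans (ler_normD _ _) (lerD a1 ex'))
                      (le_trans (ler_normD _ _) (lerD a2 a3))) _.
by have := sqr_ge0 n; lra.
Qed.

End ComplexExponential.

(** * Gauss's product and the poles of Gamma *)

Section Gauss.
Variable R : realType.
Local Notation C := R[i].

Definition gauss_ratio (s : C) (n : nat) : C :=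
  (1 + s / n.+1%:R) * cexp (- s * (ln n.+1%:R - ln n%:R)%:C).

Lemma inv_Gamma_seqS (s : C) n :
  inv_Gamma_seq s n.+1 = inv_Gamma_seq s n * gauss_ratio s n.
Proof.
rewrite /inv_Gamma_seq /gauss_ratio big_ord_recr factS natrM /=.
have -> : cexp (- s * (ln n.+1%:R)%:C) =
    cexp (- s * (ln n%:R)%:C) * cexp (- s * (ln n.+1%:R - ln n%:R)%:C).
  by rewrite -cexpD -mulrDr -rmorphD addrC subrK.
have n1 : n.+1%:R != 0 :> C by rewrite pnatr_eq0.
have f0 : n`!%:R != 0 :> C by rewrite pnatr_eq0 -lt0n fact_gt0.
by field; rewrite addrC natr1 n1.
Qed.

(** Both bounds are [ln (1 + x) <= x], at [x = - 1 / (n + 1)] and at [x = 1 / n]. *)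
Lemma ln_gap n : (0 < n)%N ->
  n.+1%:R^-1 <= ln n.+1%:R - ln n%:R :> R /\
  ln n.+1%:R - ln n%:R <= n%:R^-1 :> R.
Proof.
move=> n0; have n0' : 0 < n%:R :> R by rewrite ltr0n.
have n1' : 0 < n.+1%:R :> R by rewrite ltr0n.
split.
  have : ln (1 + - n.+1%:R^-1) <= - n.+1%:R^-1 :> R.
    by apply: le_ln1Dx; rewrite ltrN2 invf_lt1 // ltr1n.
  have -> : 1 + - n.+1%:R^-1 = n%:R / n.+1%:R :> R.
    by rewrite -(natr1 n); field; rewrite natr1 lt0r_neq0.
  by rewrite ln_div ?posrE // -opprB lerN2.
have : ln (1 + n%:R^-1) <= n%:R^-1 :> R.
  by apply: le_ln1Dx; apply: lt_trans (_ : 0 < _); rewrite ?invr_gt0 //; lra.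
have -> : 1 + n%:R^-1 = n.+1%:R / n%:R :> R.
  by rewrite -(natr1 n); field; rewrite lt0r_neq0.
by rewrite ln_div ?posrE.
Qed.

(** Write [h = 1 / (n + 1)], [g = 1 / n] and [t] for the logarithmic gap. The first-order term is
    [s * (h - t)], and [h <= t <= g] makes it [O(g - h)]; the term in [s ^+ 2] is controlled by
    [h * t <= g * h = g - h]. The constant 44 is 1 + 1 for these two terms plus 42 for the remainder
    of the exponential. *)
Lemma gauss_ratio_bound (S : R) (s : C) n : 1 <= S -> normc s <= S ->
  2 * S <= n%:R -> normc (gauss_ratio s n - 1) <= 44 * S ^+ 2 * inv_gap R n.
Proof.
move=> S1 sS Sn; have n0' : 0 < n%:R :> R by lra.
have n0 : (0 < n)%N by rewrite -(ltr0n R).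
have [ht tg] := @ln_gap n n0.
have n1' : 0 < n.+1%:R :> R by rewrite ltr0n.
rewrite /gauss_ratio; move: ht tg; move: (ln n.+1%:R - ln n%:R) => t; rewrite /inv_gap.
have hE : (n.+1%:R^-1 : C) = (n.+1%:R^-1 : R)%:C by rewrite fmorphV rmorph_nat.
rewrite hE; have gh : n%:R^-1 * n.+1%:R^-1 = n%:R^-1 - n.+1%:R^-1 :> R.
  by rewrite -(natr1 n); field; rewrite natr1 !gt_eqF.
have Sg : S * n%:R^-1 <= 1 / 2 by rewrite ler_pdivrMr //; lra.
have h0 : 0 < n.+1%:R^-1 :> R by rewrite invr_gt0.
have g0 : 0 < n%:R^-1 :> R by rewrite invr_gt0.
have g1 : n%:R^-1 <= 1 :> R by rewrite invf_le1 // ler1n.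
move: (n%:R^-1 : R) (n.+1%:R^-1 : R) gh Sg h0 g0 g1 => g h gh Sg h0 g0 g1 ht tg.
have s0 := normc_ge0 s; have t0 : 0 <= t by lra.
have zn : normc (- s * t%:C) = normc s * t.
  by rewrite normcM normcNE normc_real ger0_norm.
have st : normc s * t <= S * g by rewrite ler_pM.
have z2 : normc (- s * t%:C) <= 1 / 2 by rewrite zn; lra.
have := cexp_bound z2; rewrite zn; set E := _ - _ - _ => hE'.
have -> : (1 + s * h%:C) * cexp (- s * t%:C) - 1 =
    (s * (h - t)%:C - s ^+ 2 * (h * t)%:C) + (1 + s * h%:C) * E.
  by rewrite /E rmorphB rmorphM /=; ring.
have e1 : normc (s * (h - t)%:C) <= S * (g - h).
  by rewrite normcM normc_real distrC ger0_norm ?ler_pM //; lra.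
have e2 : normc (- (s ^+ 2 * (h * t)%:C)) <= S ^+ 2 * (g - h).
  rewrite normcNE expr2 !normcM normc_real ger0_norm; last by rewrite mulr_ge0 // ltW.
  rewrite -gh (mulrC g) expr2; apply: ler_pM; rewrite ?mulr_ge0 ?ler_pM // ltW //.
have e3 : normc (1 + s * h%:C) <= 3 / 2.
  apply: le_trans (normcD _ _) _; rewrite normc1 normcM normc_real (ger0_norm (ltW h0)).
  have : normc s * h <= S * g by rewrite ler_pM ?(ltW h0) //; lra.
  by lra.
(* As [n >= 1], [g <= 2 * h]; hence [g ^+ 2 <= 2 * (g - h)], which doubles the 14 of
   [cexp_bound]. *)
have e4 : normc E <= 28 * S ^+ 2 * (g - h).
  apply: le_trans hE' _; have : (normc s * t) ^+ 2 <= (S * g) ^+ 2.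
    by rewrite ler_pXn2r ?nnegrE ?mulr_ge0 //; lra.
  have : 0 <= S ^+ 2 * (2 * (g - h) - g ^+ 2).
    rewrite mulr_ge0 ?sqr_ge0 // -gh.
    have : 0 <= g * (2 * h - g) by rewrite mulr_ge0 //; nra.
    by rewrite expr2; lra.
  by rewrite exprMn; lra.
have e5 : normc ((1 + s * h%:C) * E) <= 3 / 2 * (28 * S ^+ 2 * (g - h)).
  by rewrite normcM ler_pM ?normc_ge0.
have SS : S * (g - h) <= S ^+ 2 * (g - h).
  by rewrite ler_wpM2r ?subr_ge0 ?(le_trans ht) // expr2 ler_peMr //; lra.
apply: le_trans (normcD _ _) _; apply: le_trans (lerD (normcD _ _) e5) _.
apply: le_trans (lerD (lerD e1 e2) (lexx _)) _.
by lra.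
Qed.

(* The bound S <= N ensures that inv_Gamma_seq s N already vanishes at the
   poles of Gamma in the disc. *)
Lemma Gamma_approx (S : R) : exists2 N : nat, S <= N%:R & forall s : C,
  normc s <= S ->
  normc ((Gamma s)^-1 - inv_Gamma_seq s N) <= normc (inv_Gamma_seq s N) / 2.
Proof.
wlog S1 : S / 1 <= S => [hw|].
  have S1 : 1 <= Num.max 1 S by rewrite le_max lexx.
  have [N N0 hN] := hw _ S1.
  by exists N => [|s sS]; [apply: le_trans N0 | apply: hN];
    rewrite le_max ?lexx ?sS orbT.
(* 176 is 4 * 44: [near_constant_cvg] is applied with [K = 44 * S ^+ 2] and asks for [4 * K <= N].
   This also gives the [2 * S <= n] of [gauss_ratio_bound]. *)
pose N := (Num.trunc (176 * S ^+ 2)).+1.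
have NS : 176 * S ^+ 2 < N%:R by rewrite truncnS_gt.
have SS : S <= S ^+ 2 by rewrite expr2 ler_peMr //; lra.
exists N => [|s sS]; first by lra.
have [|||n Nn|l cl hl] := @near_constant_cvg R (inv_Gamma_seq s) (44 * S ^+ 2) N.
- by [].
- by rewrite mulr_ge0 ?sqr_ge0.
- by lra.
- rewrite inv_Gamma_seqS -{2}[inv_Gamma_seq s n]mulr1 -mulrBr normcM mulrC.
  rewrite ler_wpM2r ?normc_ge0 // gauss_ratio_bound //.
  have : N%:R <= n%:R :> R by rewrite ler_nat.
  by lra.
rewrite /Gamma invrK; suff -> : limn (inv_Gamma_seq s : nat -> C^o) = l by [].
exact: cvg_lim cl.
Qed.

End Gauss.

(** * Orders of zeros and poles *)

Section Order.
Variable R : realType.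
Local Notation C := R[i].

(* f vanishes to the order k at s0, a pole counting as negative order. *)
Definition has_order (f : C -> C) (s0 : C) (k : int) : Prop :=
  exists d c B : R, [/\ 0 < d, 0 < c, 0 < B & forall s,
    0 < normc (s - s0) < d ->
    c * normc (s - s0) ^ k <= normc (f s) <= B * normc (s - s0) ^ k].

Lemma has_orderM f g s0 k l : has_order f s0 k -> has_order g s0 l ->
  has_order (fun s => f s * g s) s0 (k + l).
Proof.
move=> [d [c [B [d0 c0 B0 hf]]]] [d' [c' [B' [d'0 c'0 B'0 hg]]]].
exists (Num.min d d'), (c * c'), (B * B'); split; try exact: mulr_gt0.
  by rewrite lt_min d0.
move=> s /andP[s0' ]; rewrite lt_min => /andP[sd sd'].
have /andP[f1 f2] := hf s (introT andP (conj s0' sd)).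
have /andP[g1 g2] := hg s (introT andP (conj s0' sd')).
rewrite expfzDr ?gt_eqF // normcM; set u := normc (s - s0) in s0' f1 f2 g1 g2 *.
have uk : 0 <= u ^ k by rewrite exprz_ge0 // ltW.
have ul : 0 <= u ^ l by rewrite exprz_ge0 // ltW.
rewrite (mulrACA c) (mulrACA B).
by rewrite !ler_pM ?normc_ge0 // mulr_ge0 // ltW.
Qed.

Lemma has_orderV f s0 k : has_order f s0 k ->
  has_order (fun s => (f s)^-1) s0 (- k).
Proof.
move=> [d [c [B [d0 c0 B0 hf]]]].
exists d, B^-1, c^-1; split; rewrite ?invr_gt0 // => s sd.
have /andP[f1 f2] := hf s sd; have /andP[u0 _] := sd.
rewrite normcV -invr_expz -!invfM.
set u := normc _ in u0 f1 f2 *; have uk : 0 < u ^ k by rewrite exprz_gt0.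
have cu : 0 < c * u ^ k by rewrite mulr_gt0.
have fu : 0 < normc (f s) by apply: lt_le_trans f1.
by rewrite !lef_pV2 ?posrE // ?f1 ?f2 // mulr_gt0.
Qed.

Lemma has_order_near f g s0 k (d c B : R) : 0 < d -> 0 < c -> 0 < B ->
    (forall s, normc (s - s0) < d ->
      c * normc (f s) <= normc (g s) <= B * normc (f s)) ->
  has_order f s0 k -> has_order g s0 k.
Proof.
move=> d0 c0 B0 hg [d' [c' [B' [d'0 c'0 B'0 hf]]]].
exists (Num.min d d'), (c * c'), (B * B'); split; try exact: mulr_gt0.
  by rewrite lt_min d0.
move=> s /andP[s0' ]; rewrite lt_min => /andP[sd sd'].
have /andP[f1 f2] := hf s (introT andP (conj s0' sd')).
have /andP[g1 g2] := hg s sd; rewrite -!mulrA; apply/andP; split.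
  by apply: le_trans g1; rewrite ler_pM2l.
by apply: le_trans g2 _; rewrite ler_pM2l.
Qed.

Lemma has_order_bounded f s0 (d c B : R) : 0 < d -> 0 < c -> 0 < B ->
  (forall s, normc (s - s0) < d -> c <= normc (f s) <= B) -> has_order f s0 0.
Proof.
move=> d0 c0 B0 hf; exists d, c, B; split => // s /andP[_ sd].
by rewrite expr0z !mulr1 hf.
Qed.

Lemma has_order_cst (a : C) s0 : a != 0 -> has_order (fun=> a) s0 0.
Proof.
rewrite -normc_eq0 => a0.
have {}a0 : 0 < normc a by rewrite lt_def a0 normc_ge0.
by apply: (@has_order_bounded _ _ 1 (normc a) (normc a)) => // s _; rewrite !lexx.
Qed.

Lemma has_order_prod (I : Type) (r : seq I) (f : I -> C -> C) s0 (k : I -> int) :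
  (forall i, has_order (f i) s0 (k i)) ->
  has_order (fun s => \prod_(i <- r) f i s) s0 (\sum_(i <- r) k i).
Proof.
move=> hf; elim: r => [|i r IHr].
  under eq_fun do rewrite big_nil; rewrite big_nil.
  exact/has_order_cst/oner_neq0.
by under eq_fun do rewrite big_cons; rewrite big_cons; apply: has_orderM.
Qed.

Lemma has_order_comp f (phi : C -> C) s0 k :
  (forall s, normc (phi s - phi s0) = normc (s - s0)) ->
  has_order f (phi s0) k -> has_order (fun s => f (phi s)) s0 k.
Proof.
move=> iso [d [c [B [d0 c0 B0 hf]]]]; exists d, c, B; split => // s sd.
by have := hf (phi s); rewrite iso; apply.
Qed.

(** The truth value is read as the integer 1 or 0: a simple zero, or a nonzero value at [s0]. *)
Lemma has_order_addr (a s0 : C) : has_order (fun s => s + a) s0 (s0 + a == 0).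
Proof.
have e s : s + a = (s - s0) + (s0 + a) by rewrite addrA subrK.
have [z|nz] := eqVneq (s0 + a) 0.
  exists 1, 1, 1; split => // s _; rewrite e z addr0 expr1z !mul1r lexx //.
set m := normc (s0 + a).
have m0 : 0 < m by rewrite lt_def normc_eq0 nz normc_ge0.
apply: (@has_order_bounded _ _ (m / 2) (m / 2) (2 * m)); try lra.
move=> s sd; have := normcD (s - s0) (s0 + a); have := normc_sub (s0 + a) (s + a).
rewrite -e -/m (_ : s0 + a - (s + a) = s0 - s) 1?normcB; last by ring.
by move=> *; apply/andP; split; lra.
Qed.

Lemma has_order_cexp (x : R) (s0 : C) :
  has_order (fun s => cexp (- s * x%:C)) s0 0.
Proof.
set M := (normc s0 + 1) * `|x|.
apply: (@has_order_bounded _ _ 1 (expR (- M)) (expR M)); rewrite ?expR_gt0 //.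
move=> s sd; rewrite normc_cexp !ler_expR -ler_norml.
have -> : complex.Re (- s * x%:C) = - complex.Re s * x.
  by case: s {sd} => a b /=; rewrite mulr0 subr0.
rewrite normrM normrN ler_wpM2r //; apply: le_trans (le_Re_normc _) _.
by have := normc_sub s s0; lra.
Qed.

Lemma inv_Gamma_seq_order (s0 : C) N :
  has_order (fun s => inv_Gamma_seq s N) s0
    (\sum_(j < N.+1) (s0 + j%:R == 0 : bool)%:Z).
Proof.
rewrite -[X in has_order _ _ X]addr0; apply: has_orderM; last exact: has_order_cexp.
rewrite -[X in has_order _ _ X]addr0; apply: has_orderM; last first.
  by apply: has_order_cst; rewrite invr_eq0 pnatr_eq0 -lt0n fact_gt0.
by apply: has_order_prod => j; apply: has_order_addr.
Qed.

(** On the disc of radius 1 around [s0], [Gamma_approx] keeps the modulus of 1/Gamma between 1/2 and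
    3/2 of that of a fixed Gauss product, so both have the same order. The pole order [m] counts the
    linear factors of that product which vanish at [s0]. *)
Lemma Gamma_order (s0 : C) : exists2 m : nat,
  has_order (@Gamma R) s0 (- m%:Z) & (m = 0)%N <-> forall j : nat, s0 + j%:R != 0.
Proof.
have [N SN hN] := @Gamma_approx R (normc s0 + 1).
exists (\sum_(j < N.+1) ((s0 + j%:R == 0)%R : nat))%N; last first.
  split=> [/eqP|h]; last by rewrite big1 // => j _; rewrite (negbTE (h j)).
  rewrite sum_nat_eq0 => /forallP/= h j; apply/negP => sj.
  (* A zero at [s0 = - j] has [j = normc s0 <= N], so its factor does occur in the product. *)
  have jN : (j < N.+1)%N.
    rewrite ltnS -(ler_nat R); apply: le_trans SN.
    have := sj; rewrite addr_eq0 => /eqP->.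
    by rewrite normcNE normc_nat lerDl.
  by have := h (Ordinal jN); rewrite sj.
have -> : @Gamma R = fun s => ((Gamma s)^-1)^-1 by apply/funext => s; rewrite invrK.
rewrite (big_morph Posz PoszD (erefl _)); apply: has_orderV.
apply: (@has_order_near _ _ _ _ 1 (1 / 2) (3 / 2)) (inv_Gamma_seq_order s0 N);
  try lra.
move=> s sd; have := hN s ltac:(have := normc_sub s s0; lra).
have := normc_sub (Gamma s)^-1 (inv_Gamma_seq s N).
have := normc_sub (inv_Gamma_seq s N) (Gamma s)^-1; rewrite (normcB (inv_Gamma_seq s N)).
by move=> *; apply/andP; split; lra.
Qed.

Lemma dnbhs_normcP (s0 : C) (A : set C) :
  (s0 : C^o)^' A <->
  exists2 d : R, 0 < d & forall s, 0 < normc (s - s0) < d -> A s.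
Proof.
have nz s : (0 < normc (s - s0)) = (s != s0).
  by rewrite lt_def normc_ge0 andbT normc_eq0 subr_eq0.
split=> [/nbhs_ballP[e /= e0 h]|[d d0 h]].
  (* Positivity in the order of [R[i]] forces the radius to be real. *)
  move: e0; rewrite ltcE /= => /andP[/eqP ei er].
  exists (complex.Re e) => // s /andP[]; rewrite nz => ss0 sd; apply: h => //.
  by rewrite -ball_normE /= normrE_normc normcB ltcE /= ei eqxx.
apply/nbhs_ballP; exists d%:C => /=; first by rewrite ltcR.
move=> s; rewrite -ball_normE /= normrE_normc ltcR normcB => sd ss0.
by apply: h; rewrite nz ss0.
Qed.

Lemma finite_at_order f s0 (m : nat) : has_order f s0 (- m%:Z) ->
  finite_at f s0 <-> (m = 0)%N.
Proof.
move=> [d [c [B [d0 c0 B0 hf]]]]; split=> [|m0].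
  move=> [M [Mr hM]].
  have M1 : M < M + 1 by rewrite ltrDl ltr01.
  have {hM M1}/dnbhs_normcP[d' d'0 hM] := hM _ M1.
  move: Mr => /complex_realP[K MK]; rewrite {}MK in hM.
  case: m hf => // m hf; exfalso.
  (* A distance inside both punctured discs, at most 1, and so small that [c / u ^+ m.+1] exceeds
     the supposed bound [K + 1]. *)
  pose u := Num.min (Num.min (d / 2) (d' / 2)) (Num.min 1 (c / (2 * (`|K + 1| + 1)))).
  have K0 : 0 < 2 * (`|K + 1| + 1) by rewrite mulr_gt0 // ltr_wpDl.
  have u0 : 0 < u by rewrite !lt_min !divr_gt0 // ltr01.
  have ud : u < d by rewrite !gt_min ltr_pdivrMr // ltr_pMr // ltr1n.
  have ud' : u < d' by rewrite !gt_min [d' / 2 < _]ltr_pdivrMr // ltr_pMr // ltr1n orbT.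
  have u1 : u <= 1 by rewrite !ge_min lexx !orbT.
  have uc : u * (2 * (`|K + 1| + 1)) <= c by rewrite -ler_pdivlMr // !ge_min lexx !orbT.
  have e : normc (s0 + u%:C - s0) = u by rewrite addrAC subrr add0r normc_real gtr0_norm.
  have /andP[] := hf (s0 + u%:C) ltac:(by rewrite e u0).
  have := hM (s0 + u%:C) ltac:(by rewrite e u0).
  rewrite /= normrE_normc -(rmorph1 (real_complex R)) -rmorphD lecR e => h1 h2 _.
  have um : 0 < u ^+ m.+1 by rewrite exprn_gt0.
  have := le_trans h2 h1; rewrite -invr_expz -exprnP ler_pdivrMr // => h3.
  have h4 : (K + 1) * u ^+ m.+1 <= `|K + 1| * u.
    apply: le_trans (ler_wpM2r (ltW um) (ler_norm _)) _.
    rewrite ler_wpM2l // exprS ler_piMr ?(ltW u0) //.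
    by apply: exprn_ile1; rewrite ?(ltW u0).
  by nra.
rewrite m0 oppr0 in hf; exists B%:C; split; first by apply/complex_realP; exists B.
move=> M BM; apply/dnbhs_normcP; exists d => // s sd.
apply: le_trans (ltW BM); rewrite normrE_normc lecR.
by have /andP[_] := hf s sd; rewrite expr0z mulr1.
Qed.

End Order.

(** * The Weyl group of G_2 *)

(* Integer quadruples make the Weyl group computable: the entries of matrices
   are locked. *)
Definition mx2 (t : int * int * int * int) : 'M[int]_2 :=
  let: (a, b, c, d) := t in
  \matrix_(i, j) (if i == ord0 then if j == ord0 then a else b
                  else if j == ord0 then c else d).

Definition mul2 (t u : int * int * int * int) :=
  let: (a, b, c, d) := t in let: (a', b', c', d') := u in
  (a * a' + b * c', a * b' + b * d', c * a' + d * c', c * b' + d * d').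

Definition gen2 (c : bool) : int * int * int * int :=
  if c then (-1, 3, 0, 1) else (1, 0, 1, -1).

Definition word2 (u : seq bool) :=
  foldr (fun c => mul2 (gen2 c)) (1, 0, 0, 1) u.

Lemma forall_ord2 (P : 'I_2 -> Prop) : P ord0 -> P ord_max -> forall i, P i.
Proof.
move=> P0 P1 [[|[|//]] lti]; first by congr P : P0; apply: val_inj.
by congr P : P1; apply: val_inj.
Qed.

Lemma mx2M t u : mx2 (mul2 t u) = mx2 t *m mx2 u.
Proof.
case: t u => [[[a b] c] d] [[[a' b'] c'] d'].
apply/matrixP; apply: forall_ord2; apply: forall_ord2;
  by rewrite !mxE !big_ord_recl big_ord0 !mxE /= addr0.
Qed.

Lemma mx2_1 : mx2 (1, 0, 0, 1) = 1%:M.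
Proof. by apply/matrixP; apply: forall_ord2; apply: forall_ord2; rewrite !mxE. Qed.

Lemma mx2_inj : injective mx2.
Proof.
move=> [[[a b] c] d] [[[a' b'] c'] d'] /matrixP e.
move: (e ord0 ord0) (e ord0 ord_max) (e ord_max ord0) (e ord_max ord_max).
by rewrite !mxE /= => -> -> -> ->.
Qed.

Lemma mx2_gen c : mx2 (gen2 c) = if c then s_alpha else s_beta.
Proof.
case: c; apply/matrixP; apply: forall_ord2; apply: forall_ord2;
  by rewrite !mxE !big_ord_recl big_ord0 !mxE.
Qed.

Lemma weyl_wordE u : weyl_word u = mx2 (word2 u).
Proof.
rewrite /weyl_word; elim: u => [|c u IHu]; first by rewrite big_nil mx2_1.
by rewrite big_cons /= mx2M IHu mx2_gen.
Qed.

Definition alternating (c : bool) (k : nat) : seq bool :=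
  [seq c (+) odd i | i <- iota 0 k].

(** The Weyl group is dihedral of order 12, so alternating words of length at most 6 reach every
    element. The list has fourteen entries: the empty word is repeated, and the longest element has
    two words. *)
Definition reduced_words : seq (seq bool) :=
  [seq alternating c k | c <- [:: true; false], k <- iota 0 7].

Lemma reduced_words_closed : all (fun c => all (fun u =>
   has (fun v => (word2 v == word2 (c :: u)) && (size v <= (size u).+1)%N)
     reduced_words) reduced_words) [:: true; false].
Proof. by vm_compute. Qed.

(** Equality of lengths is the right claim, since the two words of the longest element differ. *)
Lemma reduced_words_inj : all (fun u => all (fun v =>
    (word2 u == word2 v) ==> (size u == size v)) reduced_words) reduced_words.
Proof. by vm_compute. Qed.

Lemma weyl_word_reduced u : exists2 v, v \in reduced_words &
  weyl_word u = weyl_word v /\ (size v <= size u)%N.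
Proof.
elim: u => [|c u [v vin [uv sz]]]; first by exists [::].
have cin : c \in [:: true; false] by case: c.
have /hasP[v' v'in /andP[/eqP e sz']] :=
  allP (allP reduced_words_closed c cin) v vin.
exists v' => //; split; last by apply: leq_trans sz' _; rewrite ltnS.
by rewrite [RHS]weyl_wordE e -weyl_wordE /weyl_word !big_cons -/(weyl_word _) uv.
Qed.

(** Any expression can be replaced by a listed word that is no longer, and listed words of the same
    element have the same length. *)
Lemma has_length_reduced u : u \in reduced_words ->
  has_length (weyl_word u) (size u).
Proof.
move=> uin; split=> [|v uv]; first by exists u.
have [v' v'in [vv' sz]] := weyl_word_reduced v.
have /implyP/(_ _)/eqP-> // := allP (allP reduced_words_inj u uin) v' v'in.
by apply/eqP/mx2_inj; rewrite -!weyl_wordE uv.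
Qed.

Lemma has_length_uniq w m n : has_length w m -> has_length w n -> m = n.
Proof.
move=> [[u [wu <-]] hm] [[v [wv <-]] hn].
by apply/eqP; rewrite eqn_leq hm // hn.
Qed.

(** The generators are involutions, so reversing a word inverts it. Invertibility is derived too,
    since [^-1] has a default value on non-units. *)
Lemma weyl_wordV u : u \in reduced_words ->
  (weyl_word u)^-1 = weyl_word (rev u).
Proof.
move=> uin; have e : mul2 (word2 u) (word2 (rev u)) = (1, 0, 0, 1).
  have /allP/(_ u uin)/eqP// : all (fun u =>
    mul2 (word2 u) (word2 (rev u)) == (1, 0, 0, 1)) reduced_words by vm_compute.
apply: (@mulrI _ (weyl_word u)).
  have := congr1 mx2 e; rewrite mx2M mx2_1 -!weyl_wordE => h.
  by have [] := mulmx1_unit h.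
rewrite divrr; last first.
  have := congr1 mx2 e; rewrite mx2M mx2_1 -!weyl_wordE => h.
  by have [] := mulmx1_unit h.
by rewrite !weyl_wordE -[RHS]/(_ *m _) -mx2M e mx2_1.
Qed.

(** * Weights of G_2 in coordinates *)

Definition vec2 (x y : int) : g2weight := \col_i (if i == ord0 then x else y).

Lemma vec2_inj x y x' y' : vec2 x y = vec2 x' y' -> x = x' /\ y = y'.
Proof.
by move=> /matrixP e; move: (e ord0 ord0) (e ord_max ord0); rewrite !mxE.
Qed.

Lemma vec2P (v w : g2weight) :
  v ord0 ord0 = w ord0 ord0 -> v ord_max ord0 = w ord_max ord0 -> v = w.
Proof.
by move=> h0 h1; apply/matrixP; apply: forall_ord2 => j; rewrite ord1.
Qed.

Lemma mul_mx2_vec2 a b c d x y :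
  mx2 (a, b, c, d) *m vec2 x y = vec2 (a * x + b * y) (c * x + d * y).
Proof.
by apply: vec2P; rewrite !mxE !big_ord_recl big_ord0 !mxE /= addr0.
Qed.

Lemma alphaE : alpha = vec2 1 0.
Proof. by apply: vec2P; rewrite !mxE. Qed.

Lemma betaE : beta = vec2 0 1.
Proof. by apply: vec2P; rewrite !mxE. Qed.

Lemma vec2D x y x' y' : vec2 x y + vec2 x' y' = vec2 (x + x') (y + y').
Proof. by apply: vec2P; rewrite !mxE. Qed.

Lemma vec2N x y : - vec2 x y = vec2 (- x) (- y).
Proof. by apply: vec2P; rewrite !mxE. Qed.

Lemma vec2Mn x y n : vec2 x y *+ n = vec2 (x * n%:Z) (y * n%:Z).
Proof.
elim: n => [|n IHn]; first by rewrite mulr0n !mulr0; apply: vec2P; rewrite !mxE.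
by rewrite mulrSr IHn vec2D; congr vec2; lia.
Qed.

Lemma vec2Mz x y n : vec2 x y *~ n = vec2 (x * n) (y * n).
Proof.
by case: n => n; rewrite ?NegzE ?mulrNz -?pmulrn vec2Mn // vec2N !mulrN.
Qed.

Definition vec2E := (alphaE, betaE, vec2Mn, vec2Mz, vec2D, vec2N).

Lemma positive_rootsE : positive_roots =
  [:: vec2 1 0; vec2 0 1; vec2 1 1; vec2 2 1; vec2 3 1; vec2 3 2].
Proof. by rewrite /positive_roots !vec2E. Qed.

Lemma rho_levi_weight ab :
  levi_weight ab + rho = vec2 (2 * ab.1 + ab.2 + 5) (ab.1 + ab.2 + 3).
Proof. rewrite /levi_weight /rho !vec2E; congr vec2; lia. Qed.

(** Both simple coroots take the value 1 on [rho]; over the integers the shift turns large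
    inequalities into strict ones. *)
Lemma g2dominantE x y :
  g2dominant (vec2 x y - rho) <-> 0 < 2 * x - 3 * y /\ 0 < 2 * y - x.
Proof.
rewrite /g2dominant /rho !vec2E !mxE !big_ord_recl !big_ord0 !mxE /=.
split; lia.
Qed.

(** For [w] in the Weyl group, [w^-1 alpha] is positive iff no reduced word of [w] starts with
    [s_alpha]. This leaves the alternating words that start with [s_beta], of length at most 5, as
    the longest element also has a word starting with [s_alpha]. *)
Definition kostant_word := alternating false.

Lemma kostant_word_reduced k : (k < 6)%N -> kostant_word k \in reduced_words.
Proof. by do 6?[case: k => [//|k]]. Qed.

Lemma size_kostant_word k : size (kostant_word k) = k.
Proof. by rewrite size_map size_iota. Qed.

Definition root2 (t : int * int * int * int) : bool :=
  let: (a, _, c, _) := t in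
  (a, c) \in [:: (1, 0); (0, 1); (1, 1); (2, 1); (3, 1); (3, 2)].

Lemma mx2_alpha_root t : (mx2 t *m alpha \in positive_roots) = root2 t.
Proof.
case: t => [[[a b] c] d]; rewrite alphaE mul_mx2_vec2 !mulr1 !mulr0 !addr0.
rewrite positive_rootsE /root2.
have inj : injective (fun p : int * int => vec2 p.1 p.2).
  by move=> [x y] [x' y'] /vec2_inj[/= -> ->].
by rewrite -(mem_map inj).
Qed.

Lemma kostant_wordV_alpha k : (k < 6)%N ->
  (weyl_word (kostant_word k))^-1 *m alpha \in positive_roots.
Proof.
move=> k6; rewrite weyl_wordV ?kostant_word_reduced // weyl_wordE mx2_alpha_root.
by do 6?[case: k k6 => [//|k] k6].
Qed.

Lemma kostantP w : in_W0 w -> w^-1 *m alpha \in positive_roots ->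
  exists2 k, (k < 6)%N & w = weyl_word (kostant_word k).
Proof.
move=> [u ->]; have [v vin [-> _]] := weyl_word_reduced u.
rewrite weyl_wordV // weyl_wordE mx2_alpha_root => rv.
have /allP/(_ v vin)/implyP/(_ rv)/hasP[k] : all (fun v => root2 (word2 (rev v)) ==>
   has (fun k => v == kostant_word k) (iota 0 6)) reduced_words by vm_compute.
by rewrite mem_iota => /andP[_ k6] /eqP->; exists k.
Qed.

Lemma kostant_length k : (k < 6)%N -> has_length (weyl_word (kostant_word k)) k.
Proof.
move=> k6; rewrite -[X in has_length _ X]size_kostant_word.
exact/has_length_reduced/kostant_word_reduced.
Qed.

(** * Dominance and Weyl chambers *)

Definition kostant_dominant (k : nat) (ab : int * int) : Prop :=
  g2dominant (dot (weyl_word (kostant_word k))^-1 (levi_weight ab)).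

(* The coroots other than that of alpha take, on the shifted weight (a, b),
   the values b + 1, a + 2 b + 4, a + b + 3, 2 a + b + 5 and a + 2; as a >= b
   the signs are increasing along this list, and the Weyl chamber is given by
   the number of negative values. *)
Definition chamber (k : nat) (ab : int * int) : Prop :=
  let: (a, b) := ab in
  match k with
  | 0%N => 0 < b + 1
  | 1%N => b + 1 < 0 < a + 2 * b + 4
  | 2%N => a + 2 * b + 4 < 0 < a + b + 3
  | 3%N => a + b + 3 < 0 < 2 * a + b + 5
  | 4%N => 2 * a + b + 5 < 0 < a + 2
  | _ => a + 2 < 0
  end.

(** Transported by the Kostant element, the two simple coroots give the two walls of its chamber.
    For [k = 0] and [k = 5] one wall is that of alpha, where the value [a - b + 1] is positive by
    dominance. *)
Lemma kostant_dominantP k ab : (k < 6)%N -> ab.2 <= ab.1 ->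
  kostant_dominant k ab <-> chamber k ab.
Proof.
case: ab => a b k6 /= leba.
rewrite /kostant_dominant /dot weyl_wordV ?kostant_word_reduced // weyl_wordE.
rewrite rho_levi_weight /=.
do 6?[case: k k6 => [|k] k6 //]; rewrite /kostant_word /= mul_mx2_vec2 g2dominantE;
  split; lia.
Qed.

(* The inequality for l3 is multiplied by 3; those of the form 2 <= l1,
   1 <= l2 and 2 <= l3 follow from the bounds. *)
Definition bounds1 (w l : int) := -1 - l <= w <= -5 + l.
Definition bounds2 (w l : int) := -2 - l <= w <= -4 + l.
Definition bounds3 (w l : int) := -7 - l <= 3 * w <= -11 + l.

Definition ell1 (w : int) (ab : int * int) : int :=
  Num.min `|2 * ab.2 - w - 1| `|2 * ab.1 - w + 1|.
Definition ell2 (w : int) (ab : int * int) : int := `|ab.1 + ab.2 - w|.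
Definition ell3 (w : int) (ab : int * int) : int :=
  Num.min `|2 * ab.1 + 4 * ab.2 - 3 * w - 1|
          `|4 * ab.1 + 2 * ab.2 - 3 * w + 1|.

(** The i-th coroot value [x] at [(a, b)] is paired with the (6 - i)-th value [y] at
    [(w - b, w - a)]. For [b + 1] and [w - b + 2] the sum is [w + 3] and the difference
    [2 * b - w - 1], so [bounds1] contains [|x + y| + 2 <= |x - y|]: both values are nonzero, of
    opposite signs. The other pairs give the remaining terms, with sums [w + 3], [2 * w + 6] and
    [3 * w + 9]. *)
Lemma chamber_bounds w ab : ab.2 <= ab.1 ->
  [/\ bounds1 w (ell1 w ab), bounds2 w (ell2 w ab) & bounds3 w (ell3 w ab)] <->
  exists2 k, (k < 6)%N & chamber k ab /\ chamber (5 - k) (w - ab.2, w - ab.1).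
Proof.
case: ab => a b /= leba.
rewrite /bounds1 /bounds2 /bounds3 /ell1 /ell2 /ell3 /=; split.
  move=> [h1 h2 h3].
  (* The index is the number of negative coroot values; the bounds exclude a zero value. *)
  have [b1|b1] := lerP 0 b; first by exists 0%N => //=; split; lia.
  have [b2|b2] := lerP 0 (a + 2 * b + 4); first by exists 1%N => //=; split; lia.
  have [b3|b3] := lerP 0 (a + b + 3); first by exists 2%N => //=; split; lia.
  have [b4|b4] := lerP 0 (2 * a + b + 5); first by exists 3%N => //=; split; lia.
  have [b5|b5] := lerP 0 (a + 2); first by exists 4%N => //=; split; lia.
  by exists 5%N => //=; split; lia.
move=> [k k6 []].
by do 6?[case: k k6 => [|k] k6 //=]; split; lia.
Qed.

(** * Weights over a number field *)

Lemma chamber_uniq k k' ab : (k < 6)%N -> (k' < 6)%N -> ab.2 <= ab.1 ->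
  chamber k ab -> chamber k' ab -> k = k'.
Proof.
case: ab => a b /= k6 k'6 leba.
do 6?[case: k k6 => [|k] k6 //]; do 6?[case: k' k'6 => [|k'] k'6 //=]; lia.
Qed.

(** A weight is a function of bundled morphisms, so pointwise equality has to be lifted to the
    bundles. *)
Lemma rmorphism_ext (A B : nzRingType) (f g : {rmorphism A -> B}) :
  f =1 g -> f = g.
Proof.
case: f g => f [[f0] [f1]] [g [[g0] [g1]]] /= fg.
have e : f = g by apply/funext.
move: f0 f1; rewrite e => f0 f1; congr GRing.RMorphism.Pack.
by rewrite (Prop_irrelevance f0 g0) (Prop_irrelevance f1 g1).
Qed.

Lemma emb_conjK (F : fieldExtType rat) : involutive (@emb_conj F).
Proof. by move=> eta; apply: rmorphism_ext => x /=; rewrite conjCK. Qed.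

(** This is purity for the trivial automorphism, at [eta] and at its conjugate. *)
Lemma strongly_pure_conj (F : fieldExtType rat) (mu : weight F) pw eta :
  strongly_pure mu pw ->
  mu (emb_conj eta) = (pw - (mu eta).2, pw - (mu eta).1).
Proof.
move=> hp; have id_comp (h : embedding F) :
    ((idfun : {rmorphism algC -> algC}) \o h : embedding F) = h.
  exact: rmorphism_ext.
have h e : (mu e).1 + (mu (emb_conj e)).2 = pw.
  have := hp (idfun : {rmorphism algC -> algC}) (idfun : {rmorphism algC -> algC})
    (fun=> erefl) (fun=> erefl) e.
  by rewrite !id_comp.
have := h eta; have := h (emb_conj eta); rewrite emb_conjK.
by case: (mu (emb_conj eta)) => a' b' /= h1 h2; congr (_, _); lia.
Qed.

(** Since the minimum is attained, conditions on [l1], [l2] and [l3] become conditions at each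
    embedding. *)
Lemma is_min_forall (T : Type) (f : T -> int) (P : int -> Prop) l :
    (forall m n, m <= n -> P m -> P n) -> is_min (range f) l ->
  P l <-> forall x, P (f x).
Proof.
move=> mono [[x _ <-] lb]; split=> [Pl y|]; last exact.
by apply: mono Pl; apply: lb; exists y.
Qed.

Lemma bounds3_rat (w l : int) :
  (- (7%:Q / 3%:Q) - l%:Q / 3%:Q <= w%:Q <= - (11%:Q / 3%:Q) + l%:Q / 3%:Q)
  = bounds3 w l.
Proof.
have h (x y : rat) : (- (7 / 3) - y / 3 <= x <= - (11 / 3) + y / 3) =
                     (- 7 - y <= 3 * x <= - 11 + y).
  by apply/andP/andP => -[]; split; lra.
rewrite /bounds3 -!(ler_int rat) (intrB _ (-7)) (intrD _ (-11)) (intrM _ 3).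
exact: h.
Qed.

(** * Inequalities at all embeddings and balanced Kostant representatives *)

Section Kostant.
Variables (F : fieldExtType rat) (mu : weight F) (pw : int).
Hypotheses (hmu : dominant_weight mu) (hpure : strongly_pure mu pw).

Let locally_bounded := forall eta : embedding F,
  [/\ bounds1 pw (ell1 pw (mu eta)), bounds2 pw (ell2 pw (mu eta))
    & bounds3 pw (ell3 pw (mu eta))].

Lemma ell_boundsP l1 l2 l3 :
    is_min (range (fun eta => ell1 pw (mu eta))) l1 ->
    is_min (range (fun eta => ell2 pw (mu eta))) l2 ->
    is_min (range (fun eta => ell3 pw (mu eta))) l3 ->
  [/\ -1 - l1 <= pw <= -5 + l1,
      -2 - l2 <= pw <= -4 + l2,
      - (7%:Q / 3%:Q) - l3%:Q / 3%:Q <= pw%:Q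
        <= - (11%:Q / 3%:Q) + l3%:Q / 3%:Q
    & [/\ 2 <= l1, 1 <= l2 & 2 <= l3]] <-> locally_bounded.
Proof.
move=> m1 m2 m3.
have b1 : bounds1 pw l1 <-> _ :=
  is_min_forall (P := bounds1 pw) ltac:(rewrite /bounds1; lia) m1.
have b2 : bounds2 pw l2 <-> _ :=
  is_min_forall (P := bounds2 pw) ltac:(rewrite /bounds2; lia) m2.
have b3 : bounds3 pw l3 <-> _ :=
  is_min_forall (P := bounds3 pw) ltac:(rewrite /bounds3; lia) m3.
apply: (@iff_trans _ [/\ bounds1 pw l1, bounds2 pw l2 & bounds3 pw l3]); last first.
  split=> [[/b1 h1 /b2 h2 /b3 h3] eta //|h].
  by split; [apply/b1|apply/b2|apply/b3] => eta; case: (h eta).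
rewrite bounds3_rat.
rewrite /bounds1 /bounds2 /bounds3; split=> [[]//|[]]; split => //; split; lia.
Qed.

(** Kostant elements are determined by their lengths, so being balanced says that the chambers at
    [eta] and at its conjugate have indices [k] and [5 - k], as in [chamber_bounds]. *)
Lemma balanced_kostantP : locally_bounded <->
  exists w : embedding F -> 'M[int]_2,
    [/\ kostant_P_alpha w, balanced w
      & forall eta, g2dominant (dot (w eta)^-1 (levi_weight (mu eta)))].
Proof.
have muC eta := strongly_pure_conj eta hpure; split=> [lb|[w [kw bw dw]] eta].
  have /choice[k hk] : forall eta, exists k, (k < 6)%N /\
      (chamber k (mu eta) /\ chamber (5 - k) (mu (emb_conj eta))).
    move=> eta; have [k k6 ch] := (chamber_bounds pw (hmu eta)).1 (lb eta).
    by exists k; rewrite muC.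
  exists (fun eta => weyl_word (kostant_word (k eta))).
  split=> eta; have [k6 [ch ch']] := hk eta.
  - by split; [exists (kostant_word (k eta)) | exact: kostant_wordV_alpha].
  - have [k6' [ch'' _]] := hk (emb_conj eta).
    exists (k eta), (k (emb_conj eta)); split; try exact: kostant_length.
    (* The indices were chosen independently at the two embeddings; uniqueness of the chamber
       reconciles them. *)
    have <- : (5 - k eta)%N = k (emb_conj eta).
      by apply: chamber_uniq ch' ch''; [lia | | exact: hmu].
    lia.
  - exact/(kostant_dominantP k6 (hmu eta)).
apply/(chamber_bounds pw (hmu eta)); rewrite -muC.
have [wW wa] := kw eta; have [w'W w'a] := kw (emb_conj eta).
have [k k6 wk] := kostantP wW wa; have [k' k'6 wk'] := kostantP w'W w'a.
have [m [n [hm hn mn]]] := bw eta.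
have km : k = m by apply: has_length_uniq hm; rewrite wk; apply: kostant_length.
have kn : k' = n by apply: has_length_uniq hn; rewrite wk'; apply: kostant_length.
exists k => //; have -> : (5 - k = k')%N by lia.
by split; [apply/(kostant_dominantP k6 (hmu _)) | apply/(kostant_dominantP k'6 (hmu _))];
  rewrite /kostant_dominant -?wk -?wk'; exact: dw.
Qed.

End Kostant.

(** * Critical points *)

Section CriticalPoints.
Variable R : realType.
Local Notation C := R[i].

Lemma Gamma_C_order (s0 : C) : exists2 m : nat,
  has_order (@Gamma_C R) s0 (- m%:Z) & (m = 0)%N <-> forall j : nat, s0 + j%:R != 0.
Proof.
have [m Gm m0] := Gamma_order s0; exists m => //.
rewrite -[- m%:Z]add0r; apply: has_orderM Gm; rewrite -[0]add0r.
by apply: has_orderM (has_order_cexp _ _); apply: has_order_cst; rewrite pnatr_eq0.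
Qed.

Definition gamma_arg (chi : quasichar R) (s : C) : C :=
  s + (qc_p chi + qc_q chi) / 2%:R + `|qc_p chi - qc_q chi| / 2%:R.

(** All Gamma factors have order at most 0, so poles cannot cancel and the total order vanishes iff
    each order does. The isometry [phi] serves for both [s] and [1 - s]. *)
Lemma L_infty_finite r n (pi : 'I_r -> principal_series R n) (phi : C -> C) s0 :
    (forall s t, normc (phi s - phi t) = normc (s - t)) ->
  finite_at (fun s => L_infty pi (phi s)) s0 <->
  forall v i (j : nat), gamma_arg (tnth (pi v) i) (phi s0) + j%:R != 0.
Proof.
move=> iso; have /choice[m hm] : forall vi : 'I_r * 'I_n, exists m : nat,
    has_order (fun s => qc_L (tnth (pi vi.1) vi.2) (phi s)) s0 (- m%:Z) /\
    ((m = 0)%N <-> forall j : nat, gamma_arg (tnth (pi vi.1) vi.2) (phi s0) + j%:R != 0).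
  move=> [v i] /=; set chi := tnth _ _.
  have [m Gm m0] := Gamma_C_order (gamma_arg chi (phi s0)); exists m; split=> //.
  apply: (@has_order_comp R (@Gamma_C R) (fun s => gamma_arg chi (phi s))) Gm => s.
  by rewrite /gamma_arg -(iso s s0); congr normc; ring.
have /finite_at_order -> : has_order (fun s => L_infty pi (phi s)) s0
    (- (\sum_(v < r) \sum_(i < n) m (v, i))%N%:Z).
  rewrite (big_morph Posz PoszD (erefl _)) -sumrN; apply: has_order_prod => v.
  rewrite (big_morph Posz PoszD (erefl _)) -sumrN; apply: has_order_prod => i.
  exact: (hm (v, i)).1.
split=> [/eqP|h].
  rewrite sum_nat_eq0 => /forallP h v i; apply/(hm (v, i)).2/eqP.
  by have := h v; rewrite /= sum_nat_eq0 => /forallP/(_ i).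
by apply: big1 => v _; apply: big1 => i _; apply/(hm (v, i)).2/h.
Qed.

(** The argument of Gamma is [(S + max P Q) / 2], an integer by the parity hypothesis, and thus
    avoids the poles iff it is positive. *)
Lemma gamma_arg_half (chi : quasichar R) (P Q S : int) :
    qc_p chi = P%:~R / 2 -> qc_q chi = Q%:~R / 2 -> (exists k, S + P = 2 * k) ->
  (forall j : nat, gamma_arg chi (S%:~R / 2) + j%:R != 0) <->
  0 < S + P \/ 0 < S + Q.
Proof.
move=> hp hq [k SP]; have [l PQ] : exists l, P - Q = 2 * l.
  have [l] := qc_int chi; rewrite hp hq => e; exists l.
  by apply: (@intr_inj C); rewrite rmorphB rmorphM /= -e; field.
have e (j : nat) : gamma_arg chi (S%:~R / 2) + j%:R =
    (S + Num.max P Q + 2 * j%:Z)%:~R / 2 :> C.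
  have -> : Num.max P Q = Q + l + `|l| by lia.
  have PE : P = Q + 2 * l by lia.
  rewrite /gamma_arg hp hq PE.
  have -> : (Q + 2 * l)%:~R / 2 - Q%:~R / 2 = l%:~R :> C.
    by rewrite rmorphD rmorphM /=; field.
  by rewrite -intr_norm !rmorphD !rmorphM /= -pmulrn; field.
have nz j : (gamma_arg chi (S%:~R / 2) + j%:R != 0) = (S + Num.max P Q + 2 * j%:Z != 0).
  by rewrite e mulf_eq0 invr_eq0 pnatr_eq0 orbF intr_eq0.
split=> [h|h j]; last by rewrite nz; case: h; lia.
(* If the argument were nonpositive, this [j] would be its opposite. *)
have := h `|(S + Num.max P Q) %/ 2|%Z%N; rewrite nz.
lia.
Qed.

Lemma critical_half r n (pi : 'I_r -> principal_series R n)
    (P Q : 'I_r -> 'I_n -> int) (S : int) :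
    (forall v i, qc_p (tnth (pi v) i) = (P v i)%:~R / 2) ->
    (forall v i, qc_q (tnth (pi v) i) = (Q v i)%:~R / 2) ->
    (forall v i, exists k, S + P v i = 2 * k) ->
    (exists k, S = n%:Z - 1 + 2 * k) ->
  critical pi (S%:~R / 2) <-> forall v i,
    (0 < S + P v i \/ 0 < S + Q v i) /\
    (0 < 2 - S + - P v i \/ 0 < 2 - S + - Q v i).
Proof.
move=> hP hQ SP [k Sk]; have e : (2 - S)%:~R / 2 = 1 - S%:~R / 2 :> C.
  by rewrite rmorphB /=; field.
have hP' v i : qc_p (tnth (contragredient (pi v)) i) = (- P v i)%:~R / 2.
  by rewrite tnth_map /= hP rmorphN mulNr.
have hQ' v i : qc_q (tnth (contragredient (pi v)) i) = (- Q v i)%:~R / 2.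
  by rewrite tnth_map /= hQ rmorphN mulNr.
have SP' v i : exists k, 2 - S + - P v i = 2 * k.
  by have [l hl] := SP v i; exists (1 - l); lia.
have f1 : finite_at (L_infty pi) (S%:~R / 2) <->
    forall v i, 0 < S + P v i \/ 0 < S + Q v i.
  rewrite (@L_infty_finite r n pi id) //.
  by split=> h v i; apply/(gamma_arg_half (hP v i) (hQ v i) (SP v i)).
have f2 : finite_at (fun s => L_infty (fun v => contragredient (pi v)) (1 - s))
      (S%:~R / 2) <->
    forall v i, 0 < 2 - S + - P v i \/ 0 < 2 - S + - Q v i.
  rewrite (@L_infty_finite r n _ (fun s => 1 - s)) => [|s t]; last first.
    by rewrite normcB; congr normc; ring.
  rewrite -e.
  by split=> h v i; apply/(gamma_arg_half (hP' v i) (hQ' v i) (SP' v i)).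
split=> [[_ /f1 h1 /f2 h2] v i //|h].
split; [|by apply/f1 => v i; case: (h v i)|by apply/f2 => v i; case: (h v i)].
by exists k; rewrite Sk rmorphD rmorphB rmorphM /= -pmulrn; field.
Qed.

Variables (F : fieldExtType rat) (mu : weight F) (pw : int).
Hypothesis hpure : strongly_pure mu pw.
Variables (r : nat) (iota : 'I_r -> embedding F).
Let sigma v := J_mu R mu (iota v).
Let omega v := central_char (sigma v).

(** [P] and [Q] are the doubled exponents of [z] and of its conjugate in the inducing characters; in
    [Q], purity has eliminated the weight at the conjugate embedding. *)
Let P v (i : 'I_2) : int :=
  let: (a, b) := mu (iota v) in if i == ord0 then 1 - 2 * b else - 2 * a - 1.
Let Q v (i : 'I_2) : int :=
  let: (a, b) := mu (iota v) in
  if i == ord0 then 2 * b - 2 * pw - 1 else 2 * a - 2 * pw + 1.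

Let J_mu_p v i : qc_p (tnth (sigma v) i) = (P v i)%:~R / 2.
Proof.
move: i; rewrite /P; case E : (mu (iota v)) => [a b].
by apply: forall_ord2; rewrite (tnth_nth (qc_one R)) /= E !(rmorphB, rmorphM) /=; field.
Qed.

Let J_mu_q v i : qc_q (tnth (sigma v) i) = (Q v i)%:~R / 2.
Proof.
move: i; rewrite /Q; have := strongly_pure_conj (iota v) hpure.
case: (mu (iota v)) => [a b] E.
apply: forall_ord2; rewrite (tnth_nth (qc_one R)) /= E /=.
  by field.
by field.
Qed.

Let omega_p v : qc_p (omega v) = (P v ord0 + P v ord_max)%:~R / 2.
Proof.
have := J_mu_p v ord0; have := J_mu_p v ord_max.
rewrite !(tnth_nth (qc_one R)) /omega /= => -> ->.
by rewrite rmorphD /=; field.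
Qed.

Let omega_q v : qc_q (omega v) = (Q v ord0 + Q v ord_max)%:~R / 2.
Proof.
have := J_mu_q v ord0; have := J_mu_q v ord_max.
rewrite !(tnth_nth (qc_one R)) /omega /= => -> ->.
by rewrite rmorphD /=; field.
Qed.

(** For each character [P] and [Q] have mean [- pw], and half their difference is, up to sign, a
    term of [ell1]; so [max P Q] is [- pw] plus that term, and the contragredient changes the sign
    of [pw]. For the central character and the twist the means are [- 2 * pw] and [- 3 * pw], the
    half differences [2 * ell2] and the terms of [ell3]. *)
Lemma critical_sigma (S : int) : (exists k : int, S = 2 * k + 1) ->
  critical sigma (S%:~R / 2) <-> forall v,
    0 < S - pw + ell1 pw (mu (iota v)) /\ 0 < 2 - S + pw + ell1 pw (mu (iota v)).
Proof.
move=> [k Sk]; rewrite (critical_half J_mu_p J_mu_q); last 2 first.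
- move=> v; rewrite /P; case: (mu (iota v)) => [a b].
  by apply: forall_ord2 => /=; [exists (k + 1 - b)|exists (k - a)]; lia.
- by exists k; lia.
split=> h v; last first.
  by move: (h v); rewrite /ell1 /P /Q; case: (mu (iota v)) => [a b] /= ? i;
    move: i; apply: forall_ord2 => /=; lia.
move: (h v ord0) (h v ord_max); rewrite /ell1 /P /Q.
by case: (mu (iota v)) => [a b] /=; lia.
Qed.

Lemma critical_omega (S : int) : (exists k : int, S = 2 * k) ->
  critical (fun v => [tuple omega v]) (S%:~R / 2) <-> forall v,
    0 < S - 2 * pw + 2 * ell2 pw (mu (iota v)) /\
    0 < 2 - S + 2 * pw + 2 * ell2 pw (mu (iota v)).
Proof.
move=> [k Sk].
rewrite (@critical_half r 1 _ (fun v _ => P v ord0 + P v ord_max)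
  (fun v _ => Q v ord0 + Q v ord_max)); last 4 first.
- by move=> v i; rewrite ord1 (tnth_nth (qc_one R)) omega_p.
- by move=> v i; rewrite ord1 (tnth_nth (qc_one R)) omega_q.
- move=> v _; rewrite /P; case: (mu (iota v)) => [a b].
  by exists (k - a - b) => /=; lia.
- by exists k; lia.
split=> h v; last first.
  move=> _; move: (h v); rewrite /ell2 /P /Q; case: (mu (iota v)) => [a b] /=; lia.
move: (h v ord0); rewrite /ell2 /P /Q; case: (mu (iota v)) => [a b] /=; lia.
Qed.

Lemma critical_twist (S : int) : (exists k : int, S = 2 * k + 1) ->
  critical (fun v => twist (sigma v) (omega v)) (S%:~R / 2) <-> forall v,
    0 < S - 3 * pw + ell3 pw (mu (iota v)) /\
    0 < 2 - S + 3 * pw + ell3 pw (mu (iota v)).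
Proof.
move=> [k Sk].
rewrite (@critical_half r 2 _ (fun v i => P v ord0 + P v ord_max + P v i)
  (fun v i => Q v ord0 + Q v ord_max + Q v i)); last 4 first.
- move=> v i; rewrite tnth_map -[LHS]/(qc_p (omega v) + qc_p (tnth (sigma v) i)).
  by rewrite omega_p J_mu_p [in RHS]intrD mulrDl.
- move=> v i; rewrite tnth_map -[LHS]/(qc_q (omega v) + qc_q (tnth (sigma v) i)).
  by rewrite omega_q J_mu_q [in RHS]intrD mulrDl.
- move=> v; rewrite /P; case: (mu (iota v)) => [a b].
  by apply: forall_ord2 => /=; [exists (k + 1 - a - 2 * b)|exists (k - 2 * a - b)]; lia.
- by exists k; lia.
split=> h v; last first.
  by move: (h v); rewrite /ell3 /P /Q; case: (mu (iota v)) => [a b] /= ? i;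
    move: i; apply: forall_ord2 => /=; lia.
move: (h v ord0) (h v ord_max); rewrite /ell3 /P /Q.
by case: (mu (iota v)) => [a b] /=; lia.
Qed.

(** For each factor, the upper bound on [pw] comes from the L-factor at the left point and the lower
    bound from the contragredient one at the right point; the other two inequalities are weaker. *)
Lemma critical_productP :
  critical_product sigma 0 (- (3%:R / 2%:R)) /\
  critical_product sigma 1 (- (3%:R / 2%:R)) <->
  forall v, let ab := mu (iota v) in
    [/\ bounds1 pw (ell1 pw ab), bounds2 pw (ell2 pw ab) & bounds3 pw (ell3 pw ab)].
Proof.
rewrite /critical_product /=.
have -> : 0 + - (3%:R / 2%:R) = (-3)%:~R / 2 :> C by rewrite rmorphN /=; field.
have -> : 1 + - (3%:R / 2%:R) = (-1)%:~R / 2 :> C by rewrite rmorphN /=; field.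
have -> : 0 + 2%:R * - (3%:R / 2%:R) = (-6)%:~R / 2 :> C by rewrite rmorphN /=; field.
have -> : 1 + 2%:R * - (3%:R / 2%:R) = (-4)%:~R / 2 :> C by rewrite rmorphN /=; field.
have -> : 0 + 3%:R * - (3%:R / 2%:R) = (-9)%:~R / 2 :> C by rewrite rmorphN /=; field.
have -> : 1 + 3%:R * - (3%:R / 2%:R) = (-7)%:~R / 2 :> C by rewrite rmorphN /=; field.
have s3 := @critical_sigma (-3) ltac:(by exists (-2)).
have s1 := @critical_sigma (-1) ltac:(by exists (-1)).
have o6 := @critical_omega (-6) ltac:(by exists (-3)).
have o4 := @critical_omega (-4) ltac:(by exists (-2)).
have t9 := @critical_twist (-9) ltac:(by exists (-5)).
have t7 := @critical_twist (-7) ltac:(by exists (-4)).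
rewrite /bounds1 /bounds2 /bounds3; split.
  move=> [[/s3 h3 /o6 h6 /t9 h9] [/s1 h1 /o4 h4 /t7 h7]] v /=.
  (* The strict inequalities are integral ones by parity. *)
  move: (h3 v) (h6 v) (h9 v) (h1 v) (h4 v) (h7 v); rewrite /ell1 /ell2 /ell3.
  by case: (mu (iota v)) => a b /=; split; lia.
by move=> h; split; split; [apply/s3|apply/o6|apply/t9|apply/s1|apply/o4|apply/t7] => v;
  have /= [] := h v; lia.
Qed.

(** Replacing [(a, b)] by [(pw - b, pw - a)] swaps the two terms of [ell1] and of [ell3] and fixes
    [ell2], so one embedding per place is enough. *)
Lemma bounds_place : place_embeddings iota ->
  (forall v, let ab := mu (iota v) in
    [/\ bounds1 pw (ell1 pw ab), bounds2 pw (ell2 pw ab) & bounds3 pw (ell3 pw ab)]) <->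
  forall eta, let ab := mu eta in
    [/\ bounds1 pw (ell1 pw ab), bounds2 pw (ell2 pw ab) & bounds3 pw (ell3 pw ab)].
Proof.
move=> hiota; split=> [h eta|h v //]; have [v [[->|->] _]] := hiota eta; first exact: h.
rewrite (strongly_pure_conj _ hpure); have := h v; case: (mu (iota v)) => [a b].
by rewrite /bounds1 /bounds2 /bounds3 /ell1 /ell2 /ell3 /= => -[]; split; lia.
Qed.

End CriticalPoints.

Theorem lemma7p2 (R : realType) (F : fieldExtType rat)
    (hF : totally_imaginary F)
    (r : nat) (iota : 'I_r -> embedding F) (hiota : place_embeddings iota)
    (mu : weight F) (pw : int)
    (hmu : dominant_weight mu) (hpure : strongly_pure mu pw)
    (sigma_infty : 'I_r -> principal_series R 2)
    (hsigma : forall v : 'I_r, sigma_infty v = J_mu R mu (iota v))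
    (l1 l2 l3 : int)
    (hl1 : is_min (range (fun eta : embedding F =>
       Num.min `|2 * (mu eta).2 - pw - 1| `|2 * (mu eta).1 - pw + 1|)) l1)
    (hl2 : is_min (range (fun eta : embedding F =>
       `|(mu eta).1 + (mu eta).2 - pw|)) l2)
    (hl3 : is_min (range (fun eta : embedding F =>
       Num.min `|2 * (mu eta).1 + 4 * (mu eta).2 - 3 * pw - 1|
               `|4 * (mu eta).1 + 2 * (mu eta).2 - 3 * pw + 1|)) l3) :
  let cond1 : Prop :=
    critical_product sigma_infty 0 (- (3%:R / 2%:R)) /\
    critical_product sigma_infty 1 (- (3%:R / 2%:R)) in
  let cond2 : Prop :=
    [/\ -1 - l1 <= pw <= -5 + l1,
        -2 - l2 <= pw <= -4 + l2,
        - (7%:Q / 3%:Q) - l3%:Q / 3%:Q <= pw%:Q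
          <= - (11%:Q / 3%:Q) + l3%:Q / 3%:Q
      & [/\ 2 <= l1, 1 <= l2 & 2 <= l3]] in
  let cond3 : Prop :=
    exists w : embedding F -> 'M[int]_2,
      [/\ kostant_P_alpha w, balanced w
        & forall eta : embedding F,
            g2dominant (dot (w eta)^-1 (levi_weight (mu eta)))] in
  (cond1 <-> cond2) /\ (cond2 <-> cond3).
Proof.
have -> : sigma_infty = fun v => J_mu R mu (iota v) by apply/funext.
have bP := ell_boundsP hl1 hl2 hl3.
split; last exact: iff_trans bP (balanced_kostantP hmu hpure).
apply: iff_trans (critical_productP R hpure iota) _.
exact: iff_trans (bounds_place hpure hiota) (iff_sym bP).
Qed.
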